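(* Let $\phi:(0,\infty)\times(0,1)\to(0,\infty)$, $(x,q)\mapsto\phi(x;q)$, satisfy, for each $q\in(0,1)$: (i) $\phi(x+1;q)=[x]_q\,\phi(x;q)$ for all $x>0$; (ii) as $x\to\infty$, $\phi$ has the asymptotic expansion $$\log\phi(x;q)\sim\left(x-\tfrac12\right)\log\left(\frac{1-q^x}{1-q}\right)+\frac{1}{\log q}\int_0^{-x\log q}\frac{u}{e^u-1}\,du;$$ (iii) the function $$x\mapsto\log\phi(x;q)-\left[\left(x-\tfrac12\right)\log\left(\frac{1-q^x}{1-q}\right)+\frac{1}{\log q}\int_0^{-x\log q}\frac{u}{e^u-1}\,du\right]$$ is decreasing in $x$ on $(0,\infty)$; (iv) $\phi(1;q)=1$. Then $\phi(x;q)=\Gamma_q(x)$ for all $x>0$ and $q\in(0,1)$.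
   Context: $[x]_q=\frac{1-q^x}{1-q}$. For $0<q<1$ and $x>0$, $\Gamma_q(x)=\frac{(q;q)_\infty}{(q^x;q)_\infty}(1-q)^{1-x}$ with $(a;q)_\infty=\prod_{k=0}^\infty(1-aq^k)$. The symbol $\sim$ denotes asymptotic equivalence (ratio tending to $1$). *)

(* Defs.v *)
From mathcomp Require Import all_boot all_order all_algebra.
From mathcomp Require Import all_classical all_reals all_analysis.
Set Implicit Arguments.
Unset Strict Implicit.
Unset Printing Implicit Defensive.
Import Order.TTheory GRing.Theory Num.Theory.
Import numFieldNormedType.Exports.
Local Open Scope classical_set_scope.
Local Open Scope ring_scope.

Section QGamma.
Variable R : realType.
Implicit Types a q x : R.

Definition qnum q x : R := (1 - q `^ x) / (1 - q).

Definition qPochhammer_inf a q : R :=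
  limn (fun n => \prod_(0 <= k < n) (1 - a * q ^+ k)).

Definition qGamma q x : R :=
  qPochhammer_inf q q / qPochhammer_inf (q `^ x) q * (1 - q) `^ (1 - x).

(* At u = 0 the integrand is 0 rather than its limit 1, because 0^-1 = 0; this
   does not affect the Lebesgue integral. *)
Definition Moak_main q x : R :=
  (x - 2^-1) * ln (qnum q x)
  + (ln q)^-1
    * \int[lebesgue_measure]_(u in `[0, - x * ln q]) (u / (expR u - 1)).

End QGamma.

(* Main.v *)
(* Write M for [Moak_main q] and g = ln phi - M.  The recurrence gives
   g(y) - g(y+1) = M(y+1) - M(y) - ln [y]_q, which tends to 0 as y -> oo because
   q^y decays exponentially and the integral in M converges.  As g is
   nonincreasing, g(y) - g(y+s) -> 0 for every s >= 0, hence
   phi(n+x) / phi(n+1) -> (1-q)^(1-x).  Unrolling the recurrence n times from x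
   and from 1 expresses phi(x) as this ratio times a quotient of two partial
   q-Pochhammer products, and n -> oo yields the product formula of Gamma_q. *)
Require Import Defs.
From mathcomp Require Import all_boot all_order all_algebra.
From mathcomp Require Import all_classical all_reals all_analysis.
From mathcomp Require Import ring lra.
Import Order.TTheory GRing.Theory Num.Theory.
Import numFieldNormedType.Exports.
Local Open Scope classical_set_scope.
Local Open Scope ring_scope.

(** Invert [1 + s <= expR s] at [s = t / (1 - t)], where [1 + s] is the inverse of [1 - t]. *)
Lemma expR_opp_div_le (R : realType) (t : R) :
  t < 1 -> expR (- (t / (1 - t))) <= 1 - t.
Proof.
move=> t1; have t1' : 0 < 1 - t by rewrite subr_gt0.
rewrite expRN -[leRHS]invrK lef_pV2 ?posrE ?expR_gt0 ?invr_gt0//.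
apply: le_trans (expR_ge1Dx _); rewrite le_eqVlt; apply/orP; left; apply/eqP.
by field; rewrite gt_eqF.
Qed.

(** * Convergence and positivity of the infinite q-Pochhammer product *)

Section qPochhammer.
Variables (R : realType) (a q : R).
Hypotheses (a01 : 0 <= a < 1) (q01 : 0 < q < 1).

Lemma qfactor_itv n : 0 < 1 - a * q ^+ n <= 1.
Proof.
case/andP: a01 => a0 a1; case/andP: q01 => q0 q1.
have qn : 0 <= q ^+ n <= 1 by rewrite exprn_ge0 ?exprn_ile1// ltW.
by nra.
Qed.

Lemma qPochhammer_gt0 n : 0 < \prod_(0 <= k < n) (1 - a * q ^+ k).
Proof. by apply: prodr_gt0 => k _; case/andP: (qfactor_itv k). Qed.

(** Each factor is at least [expR (- (a * q ^+ k / (1 - a)))], and these exponents form a geometric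
    series. The bound is uniform in [n], so the infinite product is nonzero and can be divided
    by. *)
Lemma qPochhammer_ge n :
  expR (- (a / (1 - a) / (1 - q))) <= \prod_(0 <= k < n) (1 - a * q ^+ k).
Proof.
case/andP: (a01) => a0 a1; case/andP: (q01) => q0 q1.
have geo : expR (- (series (geometric (a / (1 - a)) q) n)) <=
    \prod_(0 <= k < n) (1 - a * q ^+ k).
  rewrite /series/= -sumrN expR_sum; apply: ler_prod => k _.
  rewrite expR_ge0/=.
  have qk : 0 <= q ^+ k <= 1 by rewrite exprn_ge0 ?exprn_ile1// ltW.
  have aqk : a * q ^+ k <= a by nra.
  apply: le_trans (expR_opp_div_le _ _ (le_lt_trans aqk a1)).
  rewrite ler_expR lerN2 [leRHS]mulrAC ler_wpM2l//; first by nra.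
  by rewrite lef_pV2 ?posrE; lra.
apply: le_trans geo; rewrite ler_expR lerN2.
by apply: geometric_le_lim => //; [rewrite divr_ge0//; lra|rewrite gtr0_norm].
Qed.

Lemma is_cvg_qPochhammer : cvgn (fun n => \prod_(0 <= k < n) (1 - a * q ^+ k)).
Proof.
apply: nonincreasing_is_cvgn.
  apply/nonincreasing_seqP => n; rewrite big_nat_recr//=.
  by rewrite ler_piMr//; [exact/ltW/qPochhammer_gt0|case/andP: (qfactor_itv n)].
by exists 0 => _ [n _ <-]; exact/ltW/qPochhammer_gt0.
Qed.

Lemma qPochhammer_inf_gt0 : 0 < qPochhammer_inf a q.
Proof.
apply: (@lt_le_trans _ _ (expR (- (a / (1 - a) / (1 - q))))).
  exact: expR_gt0.
by apply: limr_ge; [exact: is_cvg_qPochhammer|near=> n; exact: qPochhammer_ge].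
Unshelve. all: by end_near. Qed.

End qPochhammer.

(** * Limits at infinity *)

Lemma cvg0_le_inv (R : realType) (f : R -> R) (K : R) :
  (forall y, 1 <= y -> `|f y| <= K / y) -> f y @[y --> +oo] --> 0.
Proof.
move=> fK; apply/cvgr0Pnorm_le => e e0; near=> y.
have y1 : 1 <= y by near: y; exact: nbhs_pinfty_ge.
apply: le_trans (fK _ y1) _; rewrite ler_pdivrMr ?(lt_le_trans ltr01)//.
by rewrite mulrC -ler_pdivrMr.
Unshelve. all: by end_near. Qed.

(** An integer shift telescopes into unit shifts; by monotonicity, the drop over [s] lies between
    [0] and the drop over an integer above [s]. *)
Lemma nonincreasing_shift_cvg0 (R : realType) (g : R -> R) (s : R) :
  (forall x y, 0 < x -> x <= y -> g y <= g x) ->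
  g y - g (y + 1) @[y --> +oo] --> 0 ->
  0 <= s -> g y - g (y + s) @[y --> +oo] --> 0.
Proof.
move=> gdecr g1 s0.
have gN N : g y - g (y + N%:R) @[y --> +oo] --> 0.
  elim: N => [|N IH].
    by under eq_cvg do rewrite addr0 subrr; exact: cvg_cst.
  rewrite -[0]addr0.
  apply: cvg_trans (cvgD IH (cvg_comp _ _ (cvg_addrr N%:R) g1)).
  apply: near_eq_cvg; near=> y => /=.
  by rewrite -natr1 (addrA y) addrA subrK.
apply: (@squeeze_cvgr _ _ _ _ (fun=> 0)
  (fun y => g y - g (y + (Num.bound s)%:R))).
- near=> y.
  have y0 : 0 < y by near: y; exact: nbhs_pinfty_gt.
  apply/andP; split; first by rewrite subr_ge0 gdecr// lerDl.
  rewrite lerD2l lerN2 gdecr ?ltr_wpDr//.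
  by rewrite lerD2l ltW// archi_boundP.
- exact: cvg_cst.
- exact: gN.
Unshelve. all: by end_near. Qed.

(** * Bounds for the integrand [u / (expR u - 1)] and its integral *)

Section Bose_integral.
Variable R : realType.
Let bose (u : R) := u / (expR u - 1).

Lemma bose_ge0 u : 0 <= u -> 0 <= bose u.
Proof. by move=> u0; rewrite divr_ge0// subr_ge0 -expR0 ler_expR. Qed.

Lemma bose_le1 u : 0 <= u -> bose u <= 1.
Proof.
rewrite /bose le_eqVlt => /predU1P[<-|u0]; first by rewrite mul0r.
have := expR_ge1Dx u => ?.
by rewrite ler_pdivrMr; lra.
Qed.

Lemma expR_ge_sqr (u : R) : 0 <= u -> 1 + u ^+ 2 / 2 <= expR u.
Proof. by move=> u0; exact: (@expR_ge1Dxn R u 1 u0). Qed.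

(** The quadratic term of the exponential gives this decay, which makes integrals over far intervals
    of fixed length small. *)
Lemma bose_le_inv u : 0 < u -> bose u <= 2 / u.
Proof.
move=> u0; have := expR_ge_sqr _ (ltW u0) => ?.
have u2 : 0 < u ^+ 2 by rewrite exprn_gt0.
rewrite /bose ler_pdivrMr; last by lra.
rewrite mulrAC ler_pdivlMr//.
by rewrite -expr2; lra.
Qed.

Lemma integrable_bose b :
  lebesgue_measure.-integrable `[0, b] (EFin \o bose).
Proof.
apply: measurable_bounded_integrable => //.
- rewrite /= lebesgue_measure_itv/=.
  by case: ifPn => // _; rewrite -EFinB ltry.
(* The integrand jumps at [0], so measurability comes from continuity on the open half-line, to
   which the endpoint is then added. *)
- have mbose : measurable_fun (`[0, +oo[ : set R) bose.
    apply/measurable_realfun.measurable_fun_itv_obnd_cbndP.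
    apply: measurable_realfun.open_continuous_measurable_fun => //.
    move=> x; rewrite inE/= in_itv/= andbT => x0.
    apply: cvgM; first exact: cvg_id.
    apply: cvgV; first by rewrite subr_eq0 gt_eqF// -expR0 ltr_expR.
    by apply: cvgB; [exact: continuous_expR|exact: cvg_cst].
  apply: measurable_funS mbose => //.
  by move=> x /=; rewrite !in_itv/= => /andP[-> _].
- exists 1; split; first by rewrite num_real.
  move=> x x1 u /=; rewrite in_itv/= => /andP[u0 _].
  by rewrite ger0_norm ?bose_ge0// (le_trans (bose_le1 _ u0))// ltW.
Qed.

(** The difference is the integral over []a, b]], where the integrand is between [0] and
    [2 / u <= 2 / a]. *)
Lemma bose_integral_sub_itv (a b : R) : 0 < a -> a <= b ->
  0 <= \int[lebesgue_measure]_(u in `[0, b]) bose u -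
    \int[lebesgue_measure]_(u in `[0, a]) bose u <= 2 / a * (b - a).
Proof.
move=> a0 ab; rewrite Rintegral_itvB ?bnd_simp ?(ltW a0)//; last first.
  exact: integrable_bose.
apply/andP; split.
  apply: Rintegral_ge0 => u /=; rewrite in_itv/= => /andP[au _].
  by apply: bose_ge0; lra.
apply: (@le_trans _ _ (\int[lebesgue_measure]_(u in `]a, b]) (2 / a))).
  apply: le_Rintegral => //.
  - apply: integrableS (integrable_bose b) => //.
    by move=> x /=; rewrite !in_itv/= => /andP[ax ->]; rewrite andbT; lra.
  - apply: measurable_bounded_integrable => //.
      rewrite /= lebesgue_measure_itv/=.
      by case: ifPn => // _; rewrite -EFinB ltry.
    exact: bounded_cst.
  - move=> u /=; rewrite in_itv/= => /andP[au _].
    apply: (le_trans (bose_le_inv _ _)); first exact: lt_trans au.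
    by rewrite ler_pM2l// lef_pV2 ?posrE; lra.
rewrite Rintegral_cst//= lebesgue_measure_itv/=.
case: ifPn => _ /=; first by [].
by rewrite mulr0 mulr_ge0 ?divr_ge0 ?subr_ge0// ltW.
Qed.

End Bose_integral.

(** * Increments of [Moak_main] at infinity *)

Section Moak_main_asymptotics.
Variables (R : realType) (q : R).
Hypothesis q01 : 0 < q < 1.

Let q_gt0 : 0 < q. Proof. by case/andP: q01. Qed.
Let lnq_lt0 : ln q < 0. Proof. exact: ln_lt0. Qed.

Lemma qpowE y : q `^ y = expR (y * ln q).
Proof. by rewrite /powR gt_eqF. Qed.

Lemma qpow_itv y : 0 < y -> 0 < q `^ y < 1.
Proof.
move=> y0; rewrite qpowE expR_gt0 -expR0 ltr_expR.
by rewrite pmulr_rlt0.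
Qed.

Lemma qnum_gt0 y : 0 < y -> 0 < qnum q y.
Proof.
move=> /qpow_itv/andP[_ qy]; case/andP: q01 => _ q1.
by rewrite divr_gt0// subr_gt0.
Qed.

Lemma ln_qnumE y : 0 < y -> ln (qnum q y) = ln (1 - q `^ y) - ln (1 - q).
Proof.
move=> /qpow_itv/andP[_ qy]; case/andP: q01 => _ q1.
by rewrite ln_div// posrE subr_gt0.
Qed.

Lemma ln_one_sub_qpow_le y : 1 <= y ->
  y * `|ln (1 - q `^ y)| <= 2 / (ln q ^+ 2 * (1 - q)) / y.
Proof.
move=> y1; have y0 : 0 < y by exact: lt_le_trans y1.
case/andP: (q01) => _ q1; have /andP[t0 t1] := qpow_itv _ y0.
have tq : q `^ y <= q.
  by rewrite qpowE -[leRHS](@lnK _ q)// ler_expR ger_nMl.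
have l0 : ln (1 - q `^ y) <= 0 by rewrite ln_le0//; lra.
have l1 : - ln (1 - q `^ y) <= q `^ y / (1 - q `^ y).
  rewrite lerNl -ler_expR lnK ?posrE ?subr_gt0//.
  exact: expR_opp_div_le.
have l2 : q `^ y / (1 - q `^ y) <= q `^ y / (1 - q).
  by rewrite ler_pM2l// lef_pV2 ?posrE; lra.
have qyle : q `^ y <= 2 / (y * ln q) ^+ 2.
  have z0 : 0 < - (y * ln q) by rewrite oppr_gt0 pmulr_rlt0.
  have := expR_ge_sqr _ _ (ltW z0); rewrite sqrrN expRN -qpowE => h.
  have z2 : 0 < (y * ln q) ^+ 2 by rewrite -sqrrN exprn_gt0.
  by move: h; rewrite -[leRHS]mul1r !ler_pdivlMr//; nra.
rewrite ler0_norm//.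
apply: (@le_trans _ _ (y * (2 / (y * ln q) ^+ 2 / (1 - q)))).
  rewrite ler_pM2l//; apply: (le_trans l1); apply: (le_trans l2).
  by rewrite ler_pM2r ?invr_gt0 ?subr_gt0.
rewrite le_eqVlt; apply/orP; left; apply/eqP.
by field; rewrite subr_eq0 (gt_eqF y0) (gt_eqF q1) lt_eqF.
Qed.

Lemma cvg_ln_one_sub_qpow : ln (1 - q `^ y) @[y --> +oo] --> (0 : R).
Proof.
apply: cvg0_le_inv => y y1; apply: le_trans (ln_one_sub_qpow_le _ y1).
by rewrite ler_peMl.
Qed.

Lemma cvg_mul_ln_one_sub_qpow :
  (y - 2^-1) * ln (1 - q `^ y) @[y --> +oo] --> (0 : R).
Proof.
apply: cvg0_le_inv => y y1; apply: le_trans (ln_one_sub_qpow_le _ y1).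
rewrite normrM ler_wpM2r// ger0_norm; lra.
Qed.

Let bose_integral y : R :=
  \int[lebesgue_measure]_(u in `[0, - y * ln q]) (u / (expR u - 1)).

Lemma cvg_bose_integral_shift s : 0 <= s ->
  bose_integral (y + s) - bose_integral y @[y --> +oo] --> (0 : R).
Proof.
(* The interval grows by [- s * ln q] beyond [- y * ln q]; in the bound [2 / a * (b - a)] the factor
   [ln q] cancels, leaving [2 * s / y]. *)
move=> s0; apply: (@cvg0_le_inv _ _ (2 * s)) => y y1.
have y0 : 0 < y by exact: lt_le_trans y1.
have a0 : 0 < - y * ln q by rewrite nmulr_rgt0// oppr_lt0.
have ab : - y * ln q <= - (y + s) * ln q by rewrite ler_wnM2r ?(ltW lnq_lt0)//; lra.
have /andP[h0 h1] := bose_integral_sub_itv _ _ _ a0 ab.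
rewrite ger0_norm//; apply: le_trans h1 _.
rewrite le_eqVlt; apply/orP; left; apply/eqP.
by field; rewrite (gt_eqF y0) lt_eqF.
Qed.

Lemma cvg_Moak_main_shift s : 0 <= s ->
  Moak_main q (y + s) - Moak_main q y @[y --> +oo] --> - s * ln (1 - q).
Proof.
move=> s0.
have h : (y + s - 2^-1) * ln (1 - q `^ (y + s)) - (y - 2^-1) * ln (1 - q `^ y)
    + (- s * ln (1 - q) + (ln q)^-1 * (bose_integral (y + s) - bose_integral y))
    @[y --> +oo] --> 0 - 0 + (- s * ln (1 - q) + (ln q)^-1 * 0).
  apply: cvgD.
    apply: cvgB cvg_mul_ln_one_sub_qpow.
    exact: cvg_comp (cvg_addrr s) cvg_mul_ln_one_sub_qpow.
  apply: cvgD; first exact: cvg_cst.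
  by apply: cvgM (cvg_bose_integral_shift _ s0); exact: cvg_cst.
rewrite subrr add0r mulr0 addr0 in h.
apply: cvg_trans h; apply: near_eq_cvg; near=> y => /=.
have y0 : 0 < y by near: y; exact: nbhs_pinfty_gt.
rewrite /Moak_main !ln_qnumE ?ltr_wpDr// -!/(bose_integral _).
by ring.
Unshelve. all: by end_near. Qed.

End Moak_main_asymptotics.

(** * Unrolling the recurrence into finite products *)

Lemma prod_qnum (R : realType) (q x : R) n : 0 < q < 1 ->
  \prod_(0 <= k < n) qnum q (x + k%:R) =
  \prod_(0 <= k < n) (1 - q `^ x * q ^+ k) / (1 - q) ^+ n.
Proof.
move=> /andP[q0 q1]; elim: n => [|n IH]; first by rewrite !big_geq// divr1.
rewrite !big_nat_recr//= IH /qnum powRD; last by rewrite (gt_eqF q0) implybT.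
by rewrite powR_mulrn ?ltW// exprSr invfM mulrACA.
Qed.

Lemma rec_prod (R : realType) (f : R -> R) (c : R -> R) x n : 0 < x ->
  (forall y, 0 < y -> f (y + 1) = c y * f y) ->
  f (x + n%:R) = \prod_(0 <= k < n) c (x + k%:R) * f x.
Proof.
move=> x0 frec; elim: n => [|n IH]; first by rewrite addr0 big_geq// mul1r.
by rewrite big_nat_recr//= -natr1 addrA frec ?ltr_wpDr// IH mulrA (mulrC (c _)).
Qed.

(** * Shift ratios of [f] and identification with [qGamma] *)

Section shift_asymptotics.
Variables (R : realType) (q : R) (f : R -> R).
Hypothesis q01 : 0 < q < 1.
Hypothesis f_gt0 : forall x, 0 < x -> 0 < f x.
Hypothesis f_rec : forall x, 0 < x -> f (x + 1) = qnum q x * f x.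
Hypothesis f_decr : forall x y, 0 < x -> x <= y ->
  ln (f y) - Moak_main q y <= ln (f x) - Moak_main q x.

Lemma cvg_ln_shift s : 0 <= s ->
  ln (f (y + s)) - ln (f y) @[y --> +oo] --> - s * ln (1 - q).
Proof.
move=> s0; pose g y := ln (f y) - Moak_main q y.
have g1 : g y - g (y + 1) @[y --> +oo] --> 0.
  (* The limit [- ln (1 - q)] of the unit increment cancels against the constant part of
     [ln (qnum q y)]. *)
  have h : Moak_main q (y + 1) - Moak_main q y - ln (1 - q `^ y) + ln (1 - q)
      @[y --> +oo] --> - 1 * ln (1 - q) - 0 + ln (1 - q).
    apply: cvgD; last exact: cvg_cst.
    apply: cvgB; last exact: cvg_ln_one_sub_qpow.
    exact: cvg_Moak_main_shift.
  rewrite subr0 mulN1r addNr in h.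
  apply: cvg_trans h; apply: near_eq_cvg; near=> y => /=.
  have y0 : 0 < y by near: y; exact: nbhs_pinfty_gt.
  rewrite /g f_rec// lnM ?posrE ?qnum_gt0 ?f_gt0// ln_qnumE//.
  by ring.
have h : Moak_main q (y + s) - Moak_main q y - (g y - g (y + s))
    @[y --> +oo] --> - s * ln (1 - q) - 0.
  apply: cvgB; first exact: cvg_Moak_main_shift.
  exact: nonincreasing_shift_cvg0.
rewrite subr0 in h.
apply: cvg_trans h; apply: near_eq_cvg; near=> y => /=.
by rewrite /g; ring.
Unshelve. all: by end_near. Qed.

Lemma cvg_shift s : 0 <= s ->
  f (n%:R + s) / f n%:R @[n --> \oo] --> (1 - q) `^ (- s).
Proof.
move=> s0; case/andP: (q01) => _ q1.
have q1' : 0 < 1 - q by rewrite subr_gt0.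
rewrite /powR gt_eqF//.
have h : expR (ln (f (n%:R + s)) - ln (f n%:R)) @[n --> \oo] -->
    expR (- s * ln (1 - q)).
  apply: continuous_cvg; first exact: continuous_expR.
  exact: cvg_comp (@cvgr_idn R) (cvg_ln_shift _ s0).
apply: cvg_trans h; apply: near_eq_cvg; near=> n => /=.
have n0 : (0 : R) < n%:R by rewrite ltr0n; near: n; exact: nbhs_infty_gt.
by rewrite expRB !lnK ?posrE ?f_gt0 ?ltr_wpDr.
Unshelve. all: by end_near. Qed.

Lemma eq_qGamma x : f 1 = 1 -> 0 < x -> f x = qGamma q x.
Proof.
move=> f1 x0; case/andP: (q01) => q0 q1.
have q1' : 0 < 1 - q by rewrite subr_gt0.
have qx01 : 0 <= q `^ x < 1.
  by have /andP[? ->] := qpow_itv _ _ q01 _ x0; rewrite andbT ltW.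
have qq01 : 0 <= q < 1 by rewrite ltW.
have prod_q n : \prod_(0 <= k < n) (1 - q * q ^+ k) =
    f (1 + n%:R) * (1 - q) ^+ n.
  rewrite (rec_prod _ _ _ _ _ ltr01 f_rec) f1 mulr1 prod_qnum// powRr1 ?ltW//.
  by rewrite divfK// expf_neq0// gt_eqF.
have prod_qx n : \prod_(0 <= k < n) (1 - q `^ x * q ^+ k) =
    f (x + n%:R) / f x * (1 - q) ^+ n.
  rewrite (rec_prod _ _ _ _ _ x0 f_rec) mulfK ?gt_eqF ?f_gt0// prod_qnum//.
  by rewrite divfK// expf_neq0// gt_eqF.
(* [f x] is viewed as a constant sequence, to be matched with one converging to [qGamma q x]. *)
have lhs : f x @[_ --> \oo] --> f x by exact: cvg_cst.
apply: cvg_unique lhs _ => //.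
(* Divide the shift limits for [x] and [1]. The denominator is at [n + 1] because [n] steps of the
   recurrence from [1] end there. *)
have ratio : f (n%:R + x) / f (n%:R + 1) @[n --> \oo] --> (1 - q) `^ (1 - x).
  have h : f (n%:R + x) / f n%:R / (f (n%:R + 1) / f n%:R) @[n --> \oo] -->
      (1 - q) `^ (- x) / (1 - q) `^ (- 1).
    apply: cvgM; first by apply: cvg_shift; exact: ltW.
    by apply: cvgV; [rewrite gt_eqF ?powR_gt0|exact: cvg_shift].
  rewrite -powRN opprK -powRD ?(gt_eqF q1') ?implybT// (addrC _ 1) in h.
  apply: cvg_trans h; apply: near_eq_cvg; near=> n => /=.
  have n0 : (0 : R) < n%:R by rewrite ltr0n; near: n; exact: nbhs_infty_gt.
  by rewrite invf_div mulrA divfK// gt_eqF// f_gt0.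
have h : \prod_(0 <= k < n) (1 - q * q ^+ k) /
    \prod_(0 <= k < n) (1 - q `^ x * q ^+ k) * (f (n%:R + x) / f (n%:R + 1))
    @[n --> \oo] --> qGamma q x.
  apply: cvgM ratio; apply: cvgM; first exact: is_cvg_qPochhammer.
  by apply: cvgV; [rewrite gt_eqF// qPochhammer_inf_gt0|exact: is_cvg_qPochhammer].
apply: cvg_trans h.
apply: near_eq_cvg; near=> n => /=.
(* The powers of [1 - q] cancel, and so do the values of [f] at [n + x] and [n + 1]; only [f x]
   remains. *)
rewrite prod_q prod_qx ![_ + n%:R]addrC.
have fN y : 0 < y -> f y != 0 by move=> y0; rewrite gt_eqF// f_gt0.
by field; rewrite !fN ?ltr_wpDl//= andbT expf_neq0// gt_eqF.
Unshelve. all: by end_near. Qed.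

End shift_asymptotics.

Theorem corollary8p3 (R : realType) (phi : R -> R -> R)
    (phi_gt0 : forall x q : R, 0 < x -> 0 < q < 1 -> 0 < phi x q)
    (phi_rec : forall q : R, 0 < q < 1 -> forall x : R, 0 < x ->
       phi (x + 1) q = qnum q x * phi x q)
    (phi_asymp : forall q : R, 0 < q < 1 ->
       (fun x : R => ln (phi x q) / Moak_main q x) @ +oo --> (1 : R))
    (phi_decr : forall q : R, 0 < q < 1 -> forall x y : R, 0 < x -> x <= y ->
       ln (phi y q) - Moak_main q y <= ln (phi x q) - Moak_main q x)
    (phi1 : forall q : R, 0 < q < 1 -> phi 1 q = 1) :
  forall x q : R, 0 < x -> 0 < q < 1 -> phi x q = qGamma q x.
Proof.
move=> x q x0 q01; apply: (eq_qGamma _ _ (phi ^~ q)) => //.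
- by move=> y y0; exact: phi_gt0.
- by move=> y y0; exact: phi_rec.
- exact: phi_decr.
- exact: phi1.
Qed.
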